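(* Let $S$ be a linearly ordered idempotent semifield, let $n\geq 1$, and let $R_n([\mathbf{0},\mathbf{1}])$ be the monoid of all $n\times n$ matrices over $S$ with all diagonal entries equal to $\mathbf{1}$ and all remaining entries in the interval $[\mathbf{0},\mathbf{1}]=\{x\in S:\mathbf{0}\leq x\leq\mathbf{1}\}$, under matrix multiplication. Then $R_n([\mathbf{0},\mathbf{1}])$ is Fountain. Moreover, each $\widetilde{\mathcal{R}}$-class and each $\widetilde{\mathcal{L}}$-class contains a unique idempotent: for $A\in R_n([\mathbf{0},\mathbf{1}])$ the unique idempotent in its $\widetilde{\mathcal{R}}$-class is $A^{(+)}$ and the unique idempotent in its $\widetilde{\mathcal{L}}$-class is $((A^T)^{(+)})^T$.
   Context: An idempotent semifield is a commutative semiring $S$ with $x+x=x$ for all $x$, in which $S^*=S\setminus\{\mathbf{0}\}$ is an abelian group under multiplication with identity $\mathbf{1}$. The natural order is $a\leq b\iff a+b=b$; addition is least upper bound and $\mathbf{0}$ is the least element. $S$ is linearly ordered if this order is total. $\bigwedge$ denotes greatest lower bound. For $x\in S^n$, $\mathrm{Supp}(x)$ is the set of indices of non-zero entries of $x$, and $A_{i,\star}$ is the $i$th row of $A$. For an $n\times n$ matrix $A$ over $S$ the matrix $A^{(+)}$ is defined by $$(A^{(+)})_{i,j}=\begin{cases}\bigwedge\{A_{i,k}A_{j,k}^{-1}: k\in\mathrm{Supp}(A_{j,\star})\} & \text{if } \emptyset\neq\mathrm{Supp}(A_{j,\star})\subseteq\mathrm{Supp}(A_{i,\star}),\\ \mathbf{0}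 & \text{otherwise.}\end{cases}$$ For a semigroup $T$: $a\,\widetilde{\mathcal{R}}\,b$ iff for all idempotents $e\in T$, $ea=a\Leftrightarrow eb=b$; $a\,\widetilde{\mathcal{L}}\,b$ iff for all idempotents $e\in T$, $ae=a\Leftrightarrow be=b$. $T$ is Fountain if every $\widetilde{\mathcal{R}}$-class and every $\widetilde{\mathcal{L}}$-class of $T$ contains an idempotent. *)

(* Defs.v *)
From HB Require Import structures.
From mathcomp Require Import all_boot all_order all_algebra.
Set Implicit Arguments.
Unset Strict Implicit.
Unset Printing Implicit Defensive.
Import GRing.Theory.
Local Open Scope ring_scope.

(* [sfinv 0] is unspecified. *)
HB.mixin Record isIdemSemifield S of GRing.ComNzSemiRing S := {
  addsfxx : forall x : S, x + x = x;
  sfinv : S -> S;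
  mulVsf : forall x : S, x != 0 -> sfinv x * x = 1
}.

#[short(type="idemSemifieldType")]
HB.structure Definition IdemSemifield :=
  {S of isIdemSemifield S & GRing.ComNzSemiRing S}.

Reserved Notation "x <=+ y" (at level 70, no associativity).

Section SemifieldTheory.
Variable S : idemSemifieldType.
Implicit Types (x y z : S) (s : seq S).

(* Not made an instance of the library's orders: these cannot be joined with
   semirings outside the ordered additive groups of [orderedzmod]. *)
Definition natle : rel S := fun x y => x + y == y.
Local Notation "x <=+ y" := (natle x y).

Lemma natle_refl : reflexive natle.
Proof. by move=> x; rewrite /natle addsfxx. Qed.

Lemma natle_anti : antisymmetric natle.
Proof. by move=> x y /andP[/eqP xy /eqP yx]; rewrite -xy addrC yx. Qed.

Lemma natle_trans : transitive natle.
Proof.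
by move=> y x z /eqP xy /eqP yz; apply/eqP; rewrite -yz addrA xy.
Qed.

Lemma natle0x x : 0 <=+ x.
Proof. by rewrite /natle add0r. Qed.

Lemma natlex0 x : (x <=+ 0) = (x == 0).
Proof. by rewrite /natle addr0. Qed.

Lemma natle_addl x y : x <=+ x + y.
Proof. by rewrite /natle addrA addsfxx. Qed.

Lemma natle_addr x y : y <=+ x + y.
Proof. by rewrite addrC natle_addl. Qed.

Lemma natle_lub x y z : (x + y <=+ z) = (x <=+ z) && (y <=+ z).
Proof.
apply/idP/andP => [xyz|[/eqP xz /eqP yz]]; last first.
  by rewrite /natle -addrA yz xz.
by split; apply: natle_trans xyz; rewrite ?natle_addl ?natle_addr.
Qed.

Lemma natle_mul2r z x y : x <=+ y -> x * z <=+ y * z.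
Proof. by rewrite /natle => /eqP xy; rewrite -mulrDl xy. Qed.

Lemma natle_mul2l z x y : x <=+ y -> z * x <=+ z * y.
Proof. by rewrite !(mulrC z); apply: natle_mul2r. Qed.

Lemma sfinv_neq0 x : x != 0 -> sfinv x != 0.
Proof.
move=> x0; apply/eqP => xV0; have := mulVsf x x0.
by rewrite xV0 mul0r => /esym/eqP; rewrite oner_eq0.
Qed.

Lemma sfinvK x : x != 0 -> sfinv (sfinv x) = x.
Proof.
move=> x0; rewrite -[LHS]mulr1 -(mulVsf x x0) mulrA mulVsf ?mul1r //.
exact: sfinv_neq0.
Qed.

Lemma natle_inv x y : x != 0 -> y != 0 -> x <=+ y -> sfinv y <=+ sfinv x.
Proof.
move=> x0 y0 /(natle_mul2l (sfinv x))/(natle_mul2r (sfinv y)).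
by rewrite mulVsf // mul1r -mulrA (mulrC y) mulVsf // mulr1.
Qed.

Definition sfmeet x y : S :=
  if (x == 0) || (y == 0) then 0 else sfinv (sfinv x + sfinv y).

Lemma sfmeet_glb z x y : (z <=+ sfmeet x y) = (z <=+ x) && (z <=+ y).
Proof.
rewrite /sfmeet; have [->|x0] := eqVneq x 0.
  by rewrite /= natlex0; case: eqVneq => // ->; rewrite natle0x.
have [->|y0] := eqVneq y 0.
  by rewrite /= natlex0 andbC; case: eqVneq => // ->; rewrite natle0x.
have [->|z0] := eqVneq z 0; first by rewrite !natle0x.
have x'0 := sfinv_neq0 x0; have y'0 := sfinv_neq0 y0.
have s0 : sfinv x + sfinv y != 0.
  by apply: contraNneq x'0 => s0; rewrite -natlex0 -s0 natle_addl.
have invE v : v != 0 -> (z <=+ sfinv v) = (v <=+ sfinv z).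
  move=> v0; apply/idP/idP => h.
    by rewrite -(sfinvK v0); apply: natle_inv => //; apply: sfinv_neq0.
  by rewrite -(sfinvK z0); apply: natle_inv => //; apply: sfinv_neq0.
by rewrite invE // natle_lub -!invE ?sfinvK.
Qed.

(* The value on the empty family is a dummy. *)
Definition sfinf s : S := if s is x :: s' then foldr sfmeet x s' else 0.

Lemma sfinf_glb s z : s != [::] -> (z <=+ sfinf s) = all (natle z) s.
Proof.
case: s => //= x s _; elim: s => [|y s IHs] /=; first by rewrite andbT.
by rewrite sfmeet_glb IHs andbCA.
Qed.

End SemifieldTheory.

Section PlusMatrix.
Variables (S : idemSemifieldType) (n : nat).

Definition supp (x : 'rV[S]_n) : {set 'I_n} := [set k | x 0 k != 0].

Definition plusmx (A : 'M[S]_n) : 'M[S]_n :=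
  \matrix_(i, j)
    if (supp (row j A) != set0) && (supp (row j A) \subset supp (row i A))
    then sfinf [seq A i k * sfinv (A j k) | k in supp (row j A)]
    else 0.

End PlusMatrix.

Section Fountain.
Variable T : semigroupType.
Local Open Scope group_scope.
Implicit Types a b e : T.

Definition idempotent_elt e : Prop := e * e = e.

Definition Rtilde a b : Prop :=
  forall e, idempotent_elt e -> (e * a = a <-> e * b = b).

Definition Ltilde a b : Prop :=
  forall e, idempotent_elt e -> (a * e = a <-> b * e = b).

Definition fountain : Prop :=
  (forall a, exists2 e, idempotent_elt e & Rtilde a e) /\
  (forall a, exists2 e, idempotent_elt e & Ltilde a e).

End Fountain.

Section UnitDiagonal.
Variables (S : idemSemifieldType) (n : nat).
Local Notation "x <=+ y" := (natle x y).

Definition unit_diag (A : 'M[S]_n) : bool :=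
  [forall i, A i i == 1] &&
  [forall i, forall j, (i != j) ==> (0 <=+ A i j) && (A i j <=+ 1)].

Record Rmx := RMx { Rmx_val :> 'M[S]_n; Rmx_valP : unit_diag Rmx_val }.

HB.instance Definition _ := [isSub for Rmx_val].
HB.instance Definition _ := [Choice of Rmx by <:].

Lemma unit_diagP (A : 'M[S]_n) :
  reflect ((forall i, A i i = 1) /\ (forall i j, A i j <=+ 1)) (unit_diag A).
Proof.
apply: (iffP andP) => [[/forallP d /forallP o]|[d o]].
  have d' i : A i i = 1 by apply/eqP.
  split=> // i j; have [<-|ij] := eqVneq i j; first by rewrite d' natle_refl.
  by have /forallP/(_ j) := o i; rewrite ij natle0x.
split; apply/forallP => i; first by rewrite d.
by apply/forallP => j; rewrite natle0x o implybT.
Qed.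

Lemma unit_diag1 : unit_diag 1%:M.
Proof.
apply/unit_diagP; split=> [i|i j]; first by rewrite mxE eqxx.
by rewrite mxE; case: eqP => _; rewrite ?natle0x ?natle_refl.
Qed.

Lemma unit_diagM (A B : 'M[S]_n) :
  unit_diag A -> unit_diag B -> unit_diag (A *m B).
Proof.
move=> /unit_diagP[dA oA] /unit_diagP[dB oB].
have le1 i j : (A *m B) i j <=+ 1.
  rewrite mxE; elim/big_ind: _ => [|x y x1 y1|k _]; first exact: natle0x.
    by rewrite natle_lub x1.
  apply: natle_trans (oB k j).
  by rewrite -{2}[B k j]mul1r; apply: natle_mul2r.
apply/unit_diagP; split=> // i; apply/natle_anti; rewrite le1 /= mxE.
by rewrite (bigD1 i) //= dA dB mulr1 natle_addl.
Qed.

Definition Rmx_one : Rmx := RMx unit_diag1.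
Definition Rmx_mul (A B : Rmx) : Rmx :=
  RMx (unit_diagM (Rmx_valP A) (Rmx_valP B)).

Lemma Rmx_mulA : associative Rmx_mul.
Proof. by move=> A B C; apply/val_inj/mulmxA. Qed.

Lemma Rmx_mul1 : left_id Rmx_one Rmx_mul.
Proof. by move=> A; apply/val_inj/mul1mx. Qed.

Lemma Rmx_mulr1 : right_id Rmx_one Rmx_mul.
Proof. by move=> A; apply/val_inj/mulmx1. Qed.

HB.instance Definition _ := isMonoid.Build Rmx Rmx_mulA Rmx_mul1 Rmx_mulr1.

End UnitDiagonal.

(* Main.v *)
Require Import Defs.
From mathcomp Require Import all_boot all_order all_algebra.
Set Implicit Arguments.
Unset Strict Implicit.
Unset Printing Implicit Defensive.
Import GRing.Theory.
Local Open Scope ring_scope.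

(** The matrix [plusmx A] is a residual: when [A] has no zero row, it is the
    greatest [X] with [X *m A <= A] for the entrywise order
    ([plusmx_residual]).  Matrices with unit diagonal are bounded below by the
    identity, so that multiplying by one of them, on either side, can only
    increase a matrix.  For [X] in [Rmx S n] this turns the inequality
    [X *m A <= A] into the equation [X *m A = A], so [P := plusmx A] is the
    greatest left stabiliser of [A].

    The rest is formal.  The product [P *m P] also stabilises [A], whence
    [P *m P <= P], and [P] is idempotent.  An idempotent [e] with [e *m A = A]
    lies below [P], whence [P <= e *m P <= P *m P = P]; conversely
    [e *m P = P] gives [e *m A = e *m P *m A = P *m A = A].  Thus [P] is in the
    R-tilde class of [A].  Two idempotents [e], [f] of one class satisfy
    [e *m f = f] and [f *m e = e], and then [e <= e *m f = f] and
    [f <= f *m e = e], so they agree.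

    Transposition is an involutive anti-automorphism of the monoid which
    exchanges the two relations, and so carries the result over to the L-tilde
    classes. *)

Section EntrywiseOrder.
Variable S : idemSemifieldType.
Implicit Types x y z : S.

Lemma natle_sum (I : finType) (F : I -> S) z :
  reflect (forall i, natle (F i) z) (natle (\sum_i F i) z).
Proof.
apply: (iffP idP) => [Fz i|Fz].
  by apply: natle_trans Fz; rewrite (bigD1 i) //= natle_addl.
by elim/big_ind: _ => [|x y xz yz|i _] //; rewrite ?natle0x ?natle_lub ?xz.
Qed.

Lemma natle_divr x y z : y != 0 -> natle x (z * sfinv y) = natle (x * y) z.
Proof.
move=> y0; apply/idP/idP => [/(natle_mul2r y)|/(natle_mul2r (sfinv y))].
  by rewrite -mulrA mulVsf // mulr1.
by rewrite -mulrA (mulrC y) mulVsf // mulr1.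
Qed.

Definition mxle m n (A B : 'M[S]_(m, n)) : Prop :=
  forall i j, natle (A i j) (B i j).

Lemma mxle_refl m n (A : 'M[S]_(m, n)) : mxle A A.
Proof. by move=> i j; apply: natle_refl. Qed.

Lemma mxle_anti m n (A B : 'M[S]_(m, n)) : mxle A B -> mxle B A -> A = B.
Proof.
by move=> AB BA; apply/matrixP => i j; apply: natle_anti; rewrite AB BA.
Qed.

Lemma mxle_mul2r m n p (C : 'M[S]_(n, p)) (A B : 'M[S]_(m, n)) :
  mxle A B -> mxle (A *m C) (B *m C).
Proof.
move=> AB i k; rewrite !mxE; apply/natle_sum => j.
apply: natle_trans (natle_mul2r _ (AB i j)) _.
exact: (natle_sum _ _ (natle_refl _)).
Qed.

(** Residuation: if [A j k] is zero for some [k] then that [k] puts no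
    constraint on [X i j], and if [A i k] vanishes but [A j k] does not then
    [X i j] must be zero, which is the second branch of [plusmx].  Zero rows
    must be excluded because [plusmx] is zero on the corresponding columns,
    where [X] would be unconstrained. *)
Lemma plusmx_residual n (A X : 'M[S]_n) :
  (forall j, supp (row j A) != set0) ->
  mxle X (plusmx A) <-> mxle (X *m A) A.
Proof.
move=> A0.
have entryP i j :
    natle (X i j) (plusmx A i j) <-> forall k, natle (X i j * A j k) (A i k).
  rewrite mxE A0 /=; case: ifPn => [_|/subsetPn[k]].
    rewrite sfinf_glb; last first.
      by rewrite -size_eq0 size_map -cardE cards_eq0.
    split=> [/allP Xle k|Xle].
      have [->|Ajk0] := eqVneq (A j k) 0; first by rewrite mulr0 natle0x.
      by rewrite -natle_divr // Xle // image_f // inE mxE.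
    apply/allP => x /imageP[k]; rewrite inE mxE => Ajk0 ->.
    by rewrite natle_divr.
  rewrite !inE !mxE negbK => Ajk0 /eqP Aik0; rewrite natlex0.
  split=> [/eqP-> k'|/(_ k)]; first by rewrite mul0r natle0x.
  by rewrite -natle_divr // Aik0 mul0r natlex0.
split=> [XP i k|XA i j].
  by rewrite mxE; apply/natle_sum => j; exact: (entryP i j).1 (XP i j) k.
apply/entryP => k; move: (XA i k); rewrite mxE => /natle_sum; exact.
Qed.

End EntrywiseOrder.

Section UnitDiagonalMonoid.
Variables (S : idemSemifieldType) (n : nat).
Implicit Types A B E : Rmx S n.
Local Open Scope group_scope.

Lemma Rmx_diag A i : A i i = 1%R.
Proof. by case/unit_diagP: (Rmx_valP A). Qed.

Lemma Rmx_le1 A i j : natle (A i j) 1%R.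
Proof. by case/unit_diagP: (Rmx_valP A). Qed.

Lemma Rmx_le_mull A (B : 'M[S]_n) : mxle B (A *m B).
Proof.
move=> i j; rewrite mxE (bigD1 i) //= Rmx_diag mul1r; exact: natle_addl.
Qed.

Lemma Rmx_le_mulr A (B : 'M[S]_n) : mxle B (B *m A).
Proof.
move=> i j; rewrite mxE (bigD1 j) //= Rmx_diag mulr1; exact: natle_addl.
Qed.

Lemma Rmx_supp_neq0 A j : supp (row j A) != set0.
Proof. by apply/set0Pn; exists j; rewrite inE mxE Rmx_diag oner_neq0. Qed.

(** As [A] has unit diagonal, the term [plusmx A i j * A j j] of the product
    [plusmx A *m A <= A] shows that [plusmx A i j <= A i j <= 1].  The
    diagonal entries are at least one because the identity stabilises [A]. *)
Lemma unit_diag_plusmx A : unit_diag (plusmx A).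
Proof.
have PA : mxle (plusmx A *m A) A.
  by apply/plusmx_residual; [apply: Rmx_supp_neq0 | apply: mxle_refl].
have le1 i j : natle (plusmx A i j) 1%R.
  apply: natle_trans (Rmx_le1 A i j).
  by have := PA i j; rewrite mxE => /natle_sum/(_ j); rewrite Rmx_diag mulr1.
apply/unit_diagP; split=> // i; apply: natle_anti; rewrite le1 /=.
have /(plusmx_residual _ (Rmx_supp_neq0 A))/(_ i i) : mxle (1%:M *m A) A.
  by rewrite mul1mx; apply: mxle_refl.
by rewrite mxE eqxx.
Qed.

Definition Rmx_plus A : Rmx S n := RMx (unit_diag_plusmx A).

(** Since [A <= E *m A] always holds, stabilising [A] is the same as the
    residuated inequality [E *m A <= A]. *)
Lemma Rmx_stabP A E : E * A = A <-> mxle E (Rmx_plus A).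
Proof.
apply: iff_trans (iff_sym (plusmx_residual _ (Rmx_supp_neq0 A))).
split=> [/(congr1 val) /= -> | EA]; first exact: mxle_refl.
by apply/val_inj/mxle_anti => //; apply: Rmx_le_mull.
Qed.

Lemma Rmx_plusK A : Rmx_plus A * A = A.
Proof. by apply/Rmx_stabP/mxle_refl. Qed.

Lemma Rmx_plus_idem A : idempotent_elt (Rmx_plus A).
Proof.
apply/val_inj/mxle_anti; last exact: Rmx_le_mull.
by apply/(Rmx_stabP A (_ * _)); rewrite -mulgA !Rmx_plusK.
Qed.

Lemma Rtilde_plus A : Rtilde A (Rmx_plus A).
Proof.
move=> e _; split=> [/Rmx_stabP eP|eP]; last first.
  by rewrite -{1}(Rmx_plusK A) mulgA eP Rmx_plusK.
apply/val_inj/mxle_anti; last exact: Rmx_le_mull.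
rewrite -[X in mxle _ (val X)](Rmx_plus_idem A); exact: mxle_mul2r.
Qed.

(** Both idempotents fix themselves, hence, being related, fix each other; as
    the product dominates each factor, this forces equality. *)
Lemma Rtilde_idem_uniq A E F :
  idempotent_elt E -> idempotent_elt F -> Rtilde A E -> Rtilde A F -> E = F.
Proof.
move=> idE idF AE AF.
have EF : E * F = F by apply/(AF E idE)/(AE E idE).
have FE : F * E = E by apply/(AE F idF)/(AF F idF).
apply/val_inj/mxle_anti.
  by rewrite -[X in mxle _ (val X)]EF; apply: Rmx_le_mulr.
by rewrite -[X in mxle _ (val X)]FE; apply: Rmx_le_mulr.
Qed.

Lemma unit_diag_tr (A : 'M[S]_n) : unit_diag A -> unit_diag A^T.
Proof.
by move=> /unit_diagP[dA oA]; apply/unit_diagP; split=> [i|i j]; rewrite mxE.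
Qed.

Definition Rmx_tr A : Rmx S n := RMx (unit_diag_tr (Rmx_valP A)).

Lemma Rmx_trK : involutive Rmx_tr.
Proof. by move=> A; apply/val_inj/trmxK. Qed.

Lemma Rmx_trM A B : Rmx_tr (A * B) = Rmx_tr B * Rmx_tr A.
Proof. by apply/val_inj/trmx_mul. Qed.

Lemma Rmx_tr_idem E : idempotent_elt E -> idempotent_elt (Rmx_tr E).
Proof. by rewrite /idempotent_elt -Rmx_trM => ->. Qed.

Lemma Ltilde_tr A B : Ltilde A B <-> Rtilde (Rmx_tr A) (Rmx_tr B).
Proof.
have stab_tr C e : Rmx_tr e * Rmx_tr C = Rmx_tr C <-> C * e = C.
  by rewrite -Rmx_trM; split=> [/(inv_inj Rmx_trK)|->].
split=> AB e /Rmx_tr_idem/AB eAB.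
  rewrite -[e]Rmx_trK.
  exact: iff_trans (stab_tr A _) (iff_trans eAB (iff_sym (stab_tr B _))).
exact: iff_trans (iff_sym (stab_tr A e)) (iff_trans eAB (stab_tr B e)).
Qed.

End UnitDiagonalMonoid.

Theorem corollary4p13 (S : idemSemifieldType) (n : nat)
    (hS : total (@natle S)) (hn : (0 < n)%N) :
  fountain (Rmx S n) /\
  forall A : Rmx S n,
    (exists2 E : Rmx S n, Rmx_val E = plusmx (Rmx_val A) &
       unique (fun e : Rmx S n => idempotent_elt e /\ Rtilde A e) E) /\
    (exists2 E : Rmx S n, Rmx_val E = (plusmx ((Rmx_val A)^T))^T &
       unique (fun e : Rmx S n => idempotent_elt e /\ Ltilde A e) E).
Proof.
pose Lplus (A : Rmx S n) := Rmx_tr (Rmx_plus (Rmx_tr A)).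
have idL A : idempotent_elt (Lplus A) by apply/Rmx_tr_idem/Rmx_plus_idem.
have AL A : Ltilde A (Lplus A).
  by apply/Ltilde_tr; rewrite Rmx_trK; apply: Rtilde_plus.
split=> [|A].
  split=> A; last by exists (Lplus A).
  by exists (Rmx_plus A); [apply: Rmx_plus_idem | apply: Rtilde_plus].
split.
  have idP := Rmx_plus_idem A; have AP := Rtilde_plus A.
  exists (Rmx_plus A) => //; split=> // e [ide Ae].
  exact: Rtilde_idem_uniq AP Ae.
exists (Lplus A) => //; split=> // e [ide Ae]; apply: (inv_inj (@Rmx_trK S n)).
apply: (@Rtilde_idem_uniq _ _ (Rmx_tr A)); try exact: Rmx_tr_idem.
  exact/Ltilde_tr/AL.
exact/Ltilde_tr.
Qed.
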